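(* Let $A$ be an $n\times n$ matrix over $\mathbb{R}$ or $\mathbb{C}$. Then there exists a diagonal matrix $D=\operatorname{diag}(d_1,\dots,d_n)$ with $d_i\in\{1,-1\}$ for all $i$ such that $$|\det(A+D)|\ge 1.$$ Consequently, $-1$ is not an eigenvalue of $DA$, and the Cayley transform $C(DA)$ is well defined. Moreover, such a matrix $D$ can be computed from $A$ by a Gaussian-elimination-type algorithm using $O(n^3)$ arithmetic operations.
   Context: $I$ denotes the $n\times n$ identity matrix. For a square matrix $B$ with $\det(B+I)\neq 0$, the Cayley transform of $B$ is $C(B)=(I-B)(B+I)^{-1}=-I+2(B+I)^{-1}$; it is said to be well defined exactly when $\det(B+I)\ne 0$. The operation count refers to exact arithmetic operations on scalars of the ground field, as is usual for Gaussian elimination. *)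

(* Defs.v *)
From HB Require Import structures.
From mathcomp Require Import all_boot all_order all_algebra.
From mathcomp Require Import all_fingroup.
From mathcomp Require Import reals.
From mathcomp Require Import complex.

Set Implicit Arguments.
Unset Strict Implicit.
Unset Printing Implicit Defensive.

Import Order.TTheory GRing.Theory Num.Theory.
Local Open Scope ring_scope.

Inductive ground := OverReals | OverComplexes.

(* Both fields are viewed as numFieldTypes, so that [`|x|] is the absolute
   value, resp. the modulus (a nonnegative real element of R[i]), and
   [1 <= `|x|] compares real numbers. *)
Definition base_field (R : realType) (f : ground) : numFieldType :=
  match f with
  | OverReals => R
  | OverComplexes => R[i]
  end.

Definition sign_vector (K : numFieldType) (n : nat) (d : 'rV[K]_n) : Prop :=
  forall i, d 0 i = 1 \/ d 0 i = -1.

(* [invmx] is total, so the partiality of the transform is made explicit. *)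
Definition cayley (K : numFieldType) (n : nat) (B : 'M[K]_n) :
    option 'M[K]_n :=
  if \det (B + 1%:M) != 0 then Some ((1%:M - B) *m invmx (B + 1%:M)) else None.

(* A language for exact algorithms on matrices of arbitrary size.  A program
   is finite and does not depend on the size n of its input: scalars are stored
   in two-dimensional arrays, named by naturals, whose entries are addressed by
   the counters of bounded loops.  Scalars are only accessible through the
   field operations, fixed integer constants, and the comparison of moduli
   used in pivoting. *)
Inductive index_expr :=
  | IVar of nat
  | IConst of nat
  | ISize
  | ISucc of index_expr.

Definition address := (nat * index_expr * index_expr)%type.

Inductive arith_op := OpAdd | OpSub | OpMul | OpDiv.

Inductive scalar_expr :=
  | EConst of int
  | ECopy of address
  | EOp of arith_op & address & address.

(* [PIfNorm x y p q] runs p if |x| <= |y| and q otherwise;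
   [PFor v lo hi p] runs p for v = lo, ..., hi - 1. *)
Inductive program :=
  | PSkip
  | PSeq of program & program
  | PAssign of address & scalar_expr
  | PIfNorm of address & address & program & program
  | PFor of nat & index_expr & index_expr & program.

Section Semantics.
Variables (K : numFieldType) (n : nat).

Definition memory := nat -> nat -> nat -> K.
Definition loop_env := nat -> nat.

Fixpoint eval_index (env : loop_env) (e : index_expr) : nat :=
  match e with
  | IVar v => env v
  | IConst k => k
  | ISize => n
  | ISucc e' => (eval_index env e').+1
  end.

Definition read (env : loop_env) (m : memory) (x : address) : K :=
  m x.1.1 (eval_index env x.1.2) (eval_index env x.2).

Definition write (env : loop_env) (m : memory) (x : address) (v : K) : memory :=
  fun a i j =>
    if [&& a == x.1.1, i == eval_index env x.1.2 & j == eval_index env x.2]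
    then v else m a i j.

(* Division by zero makes the whole computation fail. *)
Definition eval_op (o : arith_op) (x y : K) : option K :=
  match o with
  | OpAdd => Some (x + y)
  | OpSub => Some (x - y)
  | OpMul => Some (x * y)
  | OpDiv => if y == 0 then None else Some (x / y)
  end.

Definition eval_scalar (env : loop_env) (m : memory) (e : scalar_expr) :
    option K :=
  match e with
  | EConst z => Some z%:~R
  | ECopy x => Some (read env m x)
  | EOp o x y => eval_op o (read env m x) (read env m y)
  end.

Definition bind_var (env : loop_env) (v k : nat) : loop_env :=
  fun w => if w == v then k else env w.

(* The second component of a state is the operation count.  Besides arithmetic
   operations it also includes comparisons, copies and constant assignments, so
   it bounds the number of arithmetic operations from above. *)
Fixpoint exec (p : program) (env : loop_env) (st : memory * nat) {struct p} :
    option (memory * nat) :=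
  match p with
  | PSkip => Some st
  | PSeq p1 p2 => obind (exec p2 env) (exec p1 env st)
  | PAssign x e =>
      omap (fun v => (write env st.1 x v, st.2.+1)) (eval_scalar env st.1 e)
  | PIfNorm x y p1 p2 =>
      let st' := (st.1, st.2.+1) in
      if `|read env st.1 x| <= `|read env st.1 y|
      then exec p1 env st' else exec p2 env st'
  | PFor v lo hi p' =>
      let l := eval_index env lo in
      foldl (fun o k => obind (exec p' (bind_var env v k)) o) (Some st)
            (iota l (eval_index env hi - l))
  end.

(* The input matrix is array 0; all other entries are initially 0. *)
Definition input_memory (A : 'M[K]_n) : memory :=
  fun a i j =>
    match a, insub i : option 'I_n, insub j : option 'I_n with
    | 0%N, Some i', Some j' => A i' j'
    | _, _, _ => 0
    end.

Definition run (p : program) (A : 'M[K]_n) : option (memory * nat) :=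
  exec p (fun=> 0%N) (input_memory A, 0%N).

(* The output vector is column 0 of array 1. *)
Definition output_vector (m : memory) : 'rV[K]_n := \row_i m 1%N i 0%N.

(* As usual for in-place elimination, only the part of array 0 on and above the
   diagonal is relevant: the entries below may hold multipliers. *)
Definition output_upper (m : memory) : 'M[K]_n :=
  \matrix_(i, j) (if (i <= j)%N then m 0%N i j else 0).

(* U is an upper triangular matrix to which Gaussian elimination, possibly with
   row interchanges, reduces M: after a permutation of its rows, M is L U with L
   unit lower triangular. *)
Definition gaussian_elimination_result (M U : 'M[K]_n) : Prop :=
  is_trig_mx U^T /\
  exists (s : 'S_n) (L : 'M[K]_n),
    [/\ is_trig_mx L, forall i, L i i = 1 & row_perm s M = L *m U].

End Semantics.

(* Main.v *)
Require Import Defs.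
From mathcomp Require Import all_boot all_order all_algebra.
From mathcomp Require Import all_fingroup reals.
From mathcomp Require Import zify ring.

(** Eliminate without row interchanges and fix the signs along the way.  The
    entry [d_k] enters [A + D] only at position [(k, k)], and the first [k]
    elimination steps merely subtract from that position products of entries
    that do not depend on [d_k].  So the choice of [d_k] can be postponed until
    [(k, k)] becomes the pivot, with current value [x] say.  Since
    [2 = |(x + 1) - (x - 1)| <= |x + 1| + |x - 1|], the sign giving the larger
    modulus makes the pivot [x + d_k] at least 1 in modulus
    ([sign_shift_norm_ge1]).  In particular no pivot vanishes, so elimination
    never needs an interchange and yields [A + D = L U] with [L] unit lower
    triangular, whence [|det (A + D)|] is the product of the moduli of the
    pivots and is at least 1.

    The existence of [D] is thus read off from the program
    [signed_elimination].  Its correctness and its operation count are proved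
    together in a small Hoare logic, [terminates], whose triples carry a bound
    on the cost; the mathematical content of the outer loop is the invariant
    [elimination_invariant], preserved because of
    [partial_product_eliminate].

    The statement on the Cayley transform follows from
    [D A + I = D (A + D)], which holds because [D D = I]. *)

Set Implicit Arguments.
Unset Strict Implicit.
Unset Printing Implicit Defensive.

Import Order.TTheory GRing.Theory Num.Theory.
Local Open Scope ring_scope.

(** * Choosing a sign *)

(** The two moduli add up to at least 2.  Applied to [- x], this also covers the
    choice of the sign [-1]. *)
Lemma sign_shift_norm_ge1 (K : numFieldType) (x : K) :
  `|x - 1| <= `|x + 1| -> 1 <= `|x + 1|.
Proof.
move=> le_mp; have : 2%:R <= `|x + 1| + `|x - 1|.
  have -> : 2%:R = `|(x + 1) - (x - 1)| :> K.
    by rewrite (_ : x + 1 - (x - 1) = 2%:R) ?normr_nat //; ring.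
  exact: ler_normB.
move=> /le_trans /(_ (lerD (lexx _) le_mp)).
by rewrite -mulr2n lerMn2r.
Qed.

(** * A cost-annotated program logic *)

Section CostLogic.
Variables (K : numFieldType) (n : nat).
Implicit Types (p : program) (env : loop_env) (m : memory K).
Implicit Types (Q : memory K -> Prop) (c : nat).

(** Total correctness: division by zero is excluded, and [c] bounds the
    additional cost whatever the initial value [t] of the counter, which is what
    makes bounds add up under sequencing. *)
Definition terminates p env m c Q :=
  forall t, exists m' t',
    [/\ exec n p env (m, t) = Some (m', t'), (t' <= t + c)%N & Q m'].

Lemma terminates_weaken p env m c c' Q Q' :
  (c <= c')%N -> (forall m', Q m' -> Q' m') ->
  terminates p env m c Q -> terminates p env m c' Q'.
Proof.
move=> le_c QQ' H t; have [m' [t' [e le_t q]]] := H t.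
by exists m', t'; split; [|lia|exact: QQ'].
Qed.

Lemma terminates_seq p1 p2 env m c1 c2 Q :
  terminates p1 env m c1 (fun m' => terminates p2 env m' c2 Q) ->
  terminates (PSeq p1 p2) env m (c1 + c2) Q.
Proof.
move=> H t; have [m1 [t1 [e1 le1 H2]]] := H t.
have [m2 [t2 [e2 le2 q]]] := H2 t1.
by exists m2, t2; split; rewrite /= ?e1 //=; lia.
Qed.

Lemma terminates_assign x e v env m Q :
  eval_scalar n env m e = Some v -> Q (write n env m x v) ->
  terminates (PAssign x e) env m 1 Q.
Proof.
by move=> ev q t; exists (write n env m x v), t.+1; rewrite /= ev addn1.
Qed.

Lemma terminates_if x y p1 p2 env m c Q :
  (`|read n env m x| <= `|read n env m y| -> terminates p1 env m c Q) ->
  (~~ (`|read n env m x| <= `|read n env m y|) -> terminates p2 env m c Q) ->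
  terminates (PIfNorm x y p1 p2) env m c.+1 Q.
Proof.
move=> H1 H2 t; have [m' [t' [e le_t q]]] :
    exists m' t', [/\ exec n (PIfNorm x y p1 p2) env (m, t) = Some (m', t'),
                      (t' <= t.+1 + c)%N & Q m'].
  by rewrite /=; case: ifPn => [/H1|/H2]; apply.
by exists m', t'; split; rewrite // addnS.
Qed.

(** The body is charged a uniform bound [c]; the invariant [I k] describes the
    memory just before the iteration with counter [k]. *)
Lemma terminates_for v lo hi p env m c (I : nat -> memory K -> Prop) :
  let l := eval_index n env lo in let h := eval_index n env hi in
  (l <= h)%N -> I l m ->
  (forall k m', (l <= k < h)%N -> I k m' ->
     terminates p (bind_var env v k) m' c (I k.+1)) ->
  terminates (PFor v lo hi p) env m ((h - l) * c) (I h).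
Proof.
move=> l h le_lh Il step t /=; rewrite -/l -/h; clearbody l h.
have [r def_r] : exists r, r = (h - l)%N by exists (h - l)%N.
have def_h : (h = l + r)%N by lia.
have {step} : forall k m', (l <= k < l + r)%N -> I k m' ->
    terminates p (bind_var env v k) m' c (I k.+1).
  by move=> k m' kr; apply: step; rewrite def_h.
rewrite -def_r {le_lh def_r}def_h.
(* Induction on the number [r] of remaining iterations, with the starting
   counter [l] generalized. *)
elim: r l m t Il => [|r IH] l m t Il step /=.
  by exists m, t; rewrite !addn0; split.
have [|m1 [t1 [-> le1 I1]]] := step l m _ Il t; first by lia.
have [|m' [t' [e le_t q]]] := IH l.+1 m1 t1 I1.
  by move=> k m' kr; apply: step; lia.
exists m', t'; split=> //; last by rewrite addnS -addSn.
by rewrite mulSn; lia.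
Qed.

End CostLogic.

(** * One elimination step as an update of a partial LU factorization *)

Section Factorization.
Variable K : numFieldType.
Implicit Types W : nat -> nat -> K.

(** The two factors are read off from the single array [W] in which elimination
    is performed in place: multipliers below the diagonal, [U] above it.  All of
    this is on functions of naturals, to match the indexing of memories. *)
Definition lower_factor W i l : K := if (l < i)%N then W i l else (i == l)%:R.
Definition upper_factor W l j : K := if (l <= j)%N then W l j else 0.

Definition shift_pivot W k d : nat -> nat -> K :=
  fun i j => if (i == k) && (j == k) then W i j + d else W i j.

(** Step [k] of the elimination: column [k] receives the multipliers and the
    trailing block becomes a Schur complement. *)
Definition eliminate W k : nat -> nat -> K := fun i j =>
  if (k < i)%N then
    if j == k then W i k / W k k
    else if (k < j)%N then W i j - W i k / W k k * W k j else W i j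
  else W i j.

(** The matrix that a half-finished elimination stands for: the [k] completed
    columns of [L] times the [k] completed rows of [U], plus the block that is
    still to be processed. *)
Definition partial_product W k i j : K :=
  \sum_(l < k) lower_factor W i l * upper_factor W l j +
  (if (k <= i)%N && (k <= j)%N then W i j else 0).

Lemma eq_partial_product n W W' k i j :
  (forall a b, (a < n)%N -> (b < n)%N -> W a b = W' a b) ->
  (k <= n)%N -> (i < n)%N -> (j < n)%N ->
  partial_product W k i j = partial_product W' k i j.
Proof.
move=> eqW le_kn lt_in lt_jn; rewrite /partial_product eqW //; congr (_ + _).
apply: eq_bigr => l _; have lt_ln : (l < n)%N by apply: leq_trans le_kn.
by rewrite /lower_factor /upper_factor !eqW.
Qed.

(** Step [k] affects neither the multipliers in the columns before [k] nor the
    rows of [U] before [k], so it only moves the rank-one term [l = k] from the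
    trailing block to the sum.  Hence shifting the pivot by [d] beforehand has
    the sole effect of adding [d] to the represented matrix at [(k, k)]: this is
    why a sign may be chosen as late as its pivot. *)
Lemma partial_product_eliminate W k d i j :
  W k k + d != 0 ->
  partial_product (eliminate (shift_pivot W k d) k) k.+1 i j =
  partial_product W k i j + (if (i == k) && (j == k) then d else 0).
Proof.
move=> nz; rewrite /partial_product big_ord_recr /= -!addrA.
congr (_ + _).
  apply: eq_bigr => l _; have lt_lk := ltn_ord l.
  rewrite /lower_factor /upper_factor /eliminate /shift_pivot.
  rewrite (ltn_eqF lt_lk) ![(k < l)%N]ltnNge (ltnW lt_lk) /= andbF.
  by case: (k < i)%N.
rewrite /lower_factor /upper_factor /eliminate /shift_pivot ltnn eqxx /=.
case: (ltngtP k i) => [lt_ki|lt_ik|<-];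
  case: (ltngtP k j) => [lt_kj|lt_jk|<-] /=;
  rewrite ?eqxx ?ltnn ?(gtn_eqF lt_ki) ?(ltn_eqF lt_ik) /=;
  rewrite ?(gtn_eqF lt_kj) ?mulr0 ?mul0r ?mul1r ?addr0 ?add0r //.
- by rewrite addrC subrK.
- by rewrite divfK.
Qed.

End Factorization.

(** * The program *)

(** Array 0 holds the matrix and array 1 the signs; array 2 is scratch space.
    The loop variables 0, 1 and 2 are the step [k], the row [i] and the column
    [j]. *)
Definition pivot : address := (0%N, IVar 0, IVar 0).
Definition sign_entry : address := (1%N, IVar 0, IConst 0).
Definition scratch (k : nat) : address := (2%N, IConst 0, IConst k).
Definition multiplier : address := (0%N, IVar 1, IVar 0).
Definition pivot_row_entry : address := (0%N, IVar 0, IVar 2).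
Definition current_entry : address := (0%N, IVar 1, IVar 2).

Definition choose_sign :=
  PSeq (PAssign sign_entry (EConst 1))
 (PSeq (PAssign (scratch 0) (EOp OpAdd pivot sign_entry))
 (PSeq (PAssign (scratch 1) (EOp OpSub pivot sign_entry))
   (PIfNorm (scratch 1) (scratch 0)
      (PAssign pivot (ECopy (scratch 0)))
      (PSeq (PAssign sign_entry (EConst (- 1)))
            (PAssign pivot (ECopy (scratch 1))))))).

Definition update_entry :=
  PSeq (PAssign (scratch 0) (EOp OpMul multiplier pivot_row_entry))
       (PAssign current_entry (EOp OpSub current_entry (scratch 0))).

Definition eliminate_row :=
  PSeq (PAssign multiplier (EOp OpDiv multiplier pivot))
       (PFor 2 (ISucc (IVar 0)) ISize update_entry).

Definition eliminate_column := PFor 1 (ISucc (IVar 0)) ISize eliminate_row.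

Definition signed_elimination :=
  PFor 0 (IConst 0) ISize (PSeq choose_sign eliminate_column).

(** * Correctness and cost of the program *)

Section Correctness.
Variables (K : numFieldType) (n : nat).
Implicit Types (env : loop_env) (m : memory K).

Lemma choose_sign_correct env m :
  let k := env 0%N in
  terminates n choose_sign env m 6 (fun m' => exists d : K,
    [/\ d = 1 \/ d = -1, 1 <= `|m 0%N k k + d|,
        forall i j, m' 0%N i j = shift_pivot (m 0%N) k d i j
      & forall i, m' 1%N i 0%N = if i == k then d else m 1%N i 0%N]).
Proof.
move=> k; rewrite /choose_sign.
apply: (terminates_seq (c1 := 1) (c2 := 5)).
apply: (terminates_assign (v := 1)) => //.
apply: (terminates_seq (c1 := 1) (c2 := 4)).
apply: (terminates_assign (v := m 0%N k k + 1)).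
  by rewrite /= /read /write /= !eqxx.
apply: (terminates_seq (c1 := 1) (c2 := 3)).
apply: (terminates_assign (v := m 0%N k k - 1)).
  by rewrite /= /read /write /= !eqxx.
(* The program recomputes the pivot from its old value, so the new memory is
   [shift_pivot] only once the guard identifies [(i, j)] with [(k, k)]. *)
have shiftE d : forall i j,
    (if (i == k) && (j == k) then m 0%N k k + d else m 0%N i j) =
    shift_pivot (m 0%N) k d i j.
  by move=> i j; rewrite /shift_pivot; case: andP => // -[/eqP-> /eqP->].
apply: terminates_if; rewrite /read /write /=.
- move=> /sign_shift_norm_ge1 ge1.
  apply: (@terminates_weaken _ _ _ _ _ 1 _ _ _ _ (fun _ => id)) => //.
  apply: (terminates_assign (v := m 0%N k k + 1)) => //.
  exists 1; split=> //; [by left | exact: shiftE |].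
  by move=> i; rewrite /write /= andbT.
- move=> nle; apply: (terminates_seq (c1 := 1) (c2 := 1)).
  apply: (terminates_assign (v := -1)) => //.
  apply: (terminates_assign (v := m 0%N k k - 1)) => //.
  exists (-1); split=> //; [by right | | exact: shiftE |].
    (* The rejected sign [+1] gives the smaller modulus; apply the lemma to the
       opposite of the pivot. *)
    have oppE : `|m 0%N k k - 1| = `|- m 0%N k k + 1|.
      by rewrite -normrN opprB addrC.
    rewrite oppE; apply: sign_shift_norm_ge1; rewrite -oppE.
    by rewrite -normrN opprB opprK addrC ltW // real_ltNge ?normr_real.
  by move=> i; rewrite /write /= andbT; case: eqP.
Qed.

Lemma eliminate_row_correct env m :
  let k := env 0%N in let i := env 1%N in
  (k < i < n)%N -> m 0%N k k != 0 ->
  terminates n eliminate_row env m (1 + n * 2) (fun m' =>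
    (forall a b, (b < n)%N ->
       m' 0%N a b = if a == i then eliminate (m 0%N) k a b else m 0%N a b) /\
    (forall a b, m' 1%N a b = m 1%N a b)).
Proof.
move=> k i /andP[lt_ki lt_in] nz; apply: terminates_seq.
apply: (terminates_assign (v := m 0%N i k / m 0%N k k)).
  by rewrite /= /read /= (negbTE nz).
set m1 := write _ _ _ _ _.
have m1E a b : m1 0%N a b =
    if (a == i) && (b == k) then m 0%N i k / m 0%N k k else m 0%N a b by [].
have m1_signs a b : m1 1%N a b = m 1%N a b by [].
clearbody m1.
pose J j m' :=
  (forall a b, m' 0%N a b =
     if (a == i) && (k < b < j)%N then m 0%N i b - m1 0%N i k * m 0%N k b
     else m1 0%N a b) /\
  (forall a b, m' 1%N a b = m 1%N a b).
apply: (terminates_weaken _ _ (terminates_for (c := 2) (I := J) _ _ _)).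
- by rewrite leq_mul2r leq_subr orbT.
- move=> m' [E0 E1]; split=> // a b lt_bn.
  rewrite E0 !m1E /eliminate /= lt_bn andbT !eqxx.
  case: (eqVneq a i) => [->|] //=; rewrite lt_ki.
  by case: (ltngtP k b).
- exact: leq_trans lt_ki (ltnW lt_in).
- by split=> //= a b; rewrite ltnS -/k; case: leqP; rewrite ?andbF.
move=> j m2 /= /andP[]; rewrite -/k => lt_kj _ [E0 E1].
apply: (terminates_seq (c1 := 1) (c2 := 1)).
apply: (terminates_assign (v := m1 0%N i k * m 0%N k j)).
  rewrite /= /read /= /bind_var /= -/k -/i !E0 ltnn andbF; congr (Some (_ * _)).
  by rewrite !m1E (ltn_eqF lt_ki).
apply: (terminates_assign (v := m 0%N i j - m1 0%N i k * m 0%N k j)).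
  rewrite /= /read /write /= /bind_var /= -/k -/i E0 ltnn !andbF m1E.
  by rewrite (gtn_eqF lt_kj) andbF.
split=> a b; last by rewrite -E1.
rewrite /write /= /bind_var /= -/k -/i E0 ltnS.
case: (eqVneq a i) => //= _; case: (eqVneq b j) => [->|ne_bj].
  by rewrite lt_kj leqnn.
by rewrite [(b <= j)%N]leq_eqVlt (negbTE ne_bj).
Qed.

Lemma eliminate_column_correct env m :
  let k := env 0%N in
  (k < n)%N -> m 0%N k k != 0 ->
  terminates n eliminate_column env m (n * (1 + n * 2)) (fun m' =>
    (forall i j, (i < n)%N -> (j < n)%N ->
       m' 0%N i j = eliminate (m 0%N) k i j) /\
    (forall i j, m' 1%N i j = m 1%N i j)).
Proof.
move=> k lt_kn nz.
pose J i m' :=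
  (forall a b, (b < n)%N -> m' 0%N a b =
     if (a < i)%N then eliminate (m 0%N) k a b else m 0%N a b) /\
  (forall a b, m' 1%N a b = m 1%N a b).
apply: (terminates_weaken _ _
          (terminates_for (c := (1 + n * 2)%N) (I := J) _ _ _)).
- by rewrite leq_mul2r leq_subr orbT.
- by move=> m' [E0 E1]; split=> // a b lt_an lt_bn; rewrite E0 //= lt_an.
- exact: lt_kn.
- split=> // a b _; rewrite /eliminate /= ltnS -/k.
  by case: leqP => // _; case: ifP.
move=> i m1 /andP[lt_ki lt_in] [E0 E1].
(* Row [k] stays untouched, so the rows below still see the original pivot
   row. *)
have kE j : (j < n)%N -> m1 0%N k j = m 0%N k j.
  by move=> lt_jn; rewrite E0 // /eliminate ltnn; case: ifP.
apply: (terminates_weaken (leqnn _) _ (eliminate_row_correct _ _));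
  rewrite /= -/k; last first.
- by rewrite kE.
- by rewrite lt_ki.
move=> m2 [F0 F1]; split=> a b; last by rewrite F1 E1.
move=> lt_bn; rewrite F0 // ltnS leq_eqVlt E0 //.
case: (eqVneq a i) => [->|] //=.
by rewrite /eliminate !kE // !E0 // ltnn.
Qed.

Variable A : 'M[K]_n.

(** After [k] steps only the first [k] signs have been added to [A]. *)
Definition elimination_invariant (k : nat) (m : memory K) :=
  [/\ forall i, (i < k)%N -> m 1%N i 0%N = 1 \/ m 1%N i 0%N = -1,
      forall i, (i < k)%N -> 1 <= `|m 0%N i i|
    & forall i j : 'I_n, partial_product (m 0%N) k i j =
        A i j + (if (i == j) && (i < k)%N then m 1%N i 0%N else 0)].

Lemma signed_elimination_correct :
  terminates n signed_elimination (fun=> 0%N) (input_memory A)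
    (n * (6 + n * (1 + n * 2))) (elimination_invariant n).
Proof.
have H := @terminates_for K n 0 (IConst 0) ISize _ (fun=> 0%N) (input_memory A)
  (6 + n * (1 + n * 2)) elimination_invariant.
rewrite /= subn0 in H; apply: H => // [|k m lt_kn [dP uP facP]].
  split=> // i j; rewrite /partial_product big_ord0 add0r /= ltn0 andbF addr0.
  by rewrite !valK.
apply: terminates_seq.
apply: (terminates_weaken (leqnn _) _ (choose_sign_correct _ _)) => /=.
move=> m1 [d [d_sign ge1 E0 E1]].
have nz : m 0%N k k + d != 0 by rewrite -normr_gt0 (lt_le_trans ltr01).
have pivotE : m1 0%N k k = m 0%N k k + d by rewrite E0 /shift_pivot !eqxx.
apply: (terminates_weaken (leqnn _) _ (eliminate_column_correct _ _)) => //=;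
  last by rewrite pivotE.
move=> m2 [F0 F1].
have signE i : m2 1%N i 0%N = if i == k then d else m 1%N i 0%N.
  by rewrite F1 E1.
have F i j : (i < n)%N -> (j < n)%N ->
    m2 0%N i j = eliminate (shift_pivot (m 0%N) k d) k i j.
  by move=> lt_in lt_jn; rewrite F0 // /eliminate !E0.
split=> [i|i|i j].
- by rewrite signE ltnS leq_eqVlt; case: eqP => //= _; apply: dP.
- rewrite ltnS => le_ik; rewrite F ?(leq_ltn_trans le_ik) //.
  rewrite /eliminate ltnNge le_ik /= /shift_pivot.
  by case: eqP => [->|ne_ik] //=; apply: uP; lia.
(* Off the diagonal both corrections vanish; on it, [i < k], [i = k] and
   [i > k] respectively find the sign already added, just added, or not yet
   chosen. *)
- rewrite (eq_partial_product (n := n) F) // partial_product_eliminate // facP.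
  rewrite -addrA signE ltnS -val_eqE /=; congr (_ + _).
  case: (eqVneq (i : nat) j) => [<-|ne_ij] /=.
    by rewrite andbb; case: ltngtP; rewrite ?addr0 ?add0r.
  case: (eqVneq (i : nat) k) ne_ij => [->|] /=; rewrite ?add0r //.
  by rewrite eq_sym => /negbTE->.
Qed.

Lemma invariant_factorization m :
  elimination_invariant n m ->
  exists L : 'M[K]_n, [/\ is_trig_mx L, forall i, L i i = 1
    & A + diag_mx (output_vector n m) = L *m output_upper n m].
Proof.
case=> _ _ facP; exists (\matrix_(i, l) lower_factor (m 0%N) i l); split.
- apply/is_trig_mxP => i j lt_ij; rewrite mxE /lower_factor ltnNge ltnW //=.
  by rewrite (ltn_eqF lt_ij).
- by move=> i; rewrite mxE /lower_factor ltnn eqxx.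
- apply/matrixP => i j; rewrite !mxE.
  have := facP i j; rewrite /partial_product ltn_ord andbT leqNgt ltn_ord addr0.
  rewrite -mulrb => <-; apply: eq_bigr => l _.
  by rewrite !mxE.
Qed.

End Correctness.

(** * Consequences for determinants and for the Cayley transform *)

Section Determinant.
Variables (K : numFieldType) (n : nat).

Lemma norm_det_LU_ge1 (M L U : 'M[K]_n) :
  is_trig_mx L -> (forall i, L i i = 1) -> is_trig_mx U^T ->
  (forall i, 1 <= `|U i i|) -> M = L *m U -> 1 <= `|\det M|.
Proof.
move=> trigL diagL trigU diagU ->.
rewrite det_mulmx (det_trig trigL) -[\det U]det_tr (det_trig trigU).
rewrite big1 // mul1r normr_prod.
apply: (big_ind (fun x => 1 <= x)) => // [x y|i _]; first exact: mulr_ege1.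
by rewrite mxE.
Qed.

(** Since [D D = I], one has [D A + I = D (A + D)]. *)
Lemma det_sign_scale_neq0 (A : 'M[K]_n) (d : 'rV[K]_n) :
  sign_vector d -> 1 <= `|\det (A + diag_mx d)| ->
  \det (diag_mx d *m A + 1%:M) != 0.
Proof.
move=> dP ge1; have sq i : d 0 i * d 0 i = 1.
  by case: (dP i) => ->; rewrite ?mulrNN mulr1.
have -> : 1%:M = diag_mx d *m diag_mx d.
  rewrite mulmx_diag -diag_const_mx; congr diag_mx.
  by apply/rowP => i; rewrite !mxE sq.
rewrite -mulmxDr det_mulmx det_diag mulf_neq0 //; last first.
  by rewrite -normr_gt0 (lt_le_trans ltr01).
apply/prodf_neq0 => i _; apply/eqP => d0.
by have := sq i; rewrite d0 mul0r => /esym/eqP; rewrite oner_eq0.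
Qed.

Lemma det_add1_neq0_eigenvalue (B : 'M[K]_n) :
  \det (B + 1%:M) != 0 -> ~~ eigenvalue B (-1).
Proof.
move=> nz; apply/eigenvalueP => -[v vB] /eqP; apply.
have unitB : B + 1%:M \in unitmx by rewrite unitmxE unitfE.
by rewrite -[v](mulmxK unitB) mulmxDr vB mulmx1 scaleN1r addNr mul0mx.
Qed.

End Determinant.

Theorem theorem2 (R : realType) (f : ground) :
  (forall (n : nat) (A : 'M[base_field R f]_n),
     (exists d : 'rV[base_field R f]_n,
        sign_vector d /\ 1 <= `|\det (A + diag_mx d)|) /\
     (forall d : 'rV[base_field R f]_n,
        sign_vector d -> 1 <= `|\det (A + diag_mx d)| ->
        ~~ eigenvalue (diag_mx d *m A) (-1) /\
        isSome (cayley (diag_mx d *m A)))) /\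
  (exists (p : program) (c : nat),
     forall (n : nat) (A : 'M[base_field R f]_n),
       exists (m : memory (base_field R f)) (cost : nat),
         [/\ run p A = Some (m, cost),
             sign_vector (output_vector n m),
             1 <= `|\det (A + diag_mx (output_vector n m))|,
             gaussian_elimination_result
               (A + diag_mx (output_vector n m)) (output_upper n m)
           & ((0 < n)%N -> (cost <= c * n ^ 3)%N)]).
Proof.
have alg n (A : 'M[base_field R f]_n) :
    exists (m : memory (base_field R f)) (cost : nat),
      [/\ run signed_elimination A = Some (m, cost),
          sign_vector (output_vector n m),
          1 <= `|\det (A + diag_mx (output_vector n m))|,
          gaussian_elimination_result
            (A + diag_mx (output_vector n m)) (output_upper n m)
        & ((0 < n)%N -> (cost <= 9 * n ^ 3)%N)].
  have [m [cost [runE costP invP]]] := signed_elimination_correct A 0.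
  have [dP uP _] := invP.
  have [L [trigL diagL LU]] := invariant_factorization invP.
  have trigU : is_trig_mx (output_upper n m)^T.
    by apply/is_trig_mxP => i j lt_ij; rewrite !mxE leqNgt lt_ij.
  exists m, cost; split=> //.
  - by move=> i; rewrite mxE; apply: dP.
  - apply: norm_det_LU_ge1 LU => // i.
    by rewrite mxE leqnn; apply: uP.
  - by split=> //; exists 1%g, L; rewrite row_perm1.
  (* [n (6 + n (1 + 2 n)) <= 9 n^3] as soon as [1 <= n]. *)
  - by move=> n_gt0; nia.
split=> [n A|]; last by exists signed_elimination, 9%N.
split=> [|d dP ge1].
  by have [m [cost [_ dP ge1 _ _]]] := alg n A; exists (output_vector n m).
have nz := det_sign_scale_neq0 dP ge1.
by split; [exact: det_add1_neq0_eigenvalue | rewrite /cayley nz].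
Qed.
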